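(* Consider an irreducible continuous-time Markov chain on a finite set $V$ with jump rates $R$ and Donsker–Varadhan rate functional $\mathscr I$. Fix a probability measure $\mu$ on $V$ with $\mu(x)>0$ for all $x\in V$, and two signed measures $\nu_1,\nu_2:V\to\mathbb R$ with $\sum_x\nu_i(x)=0$, $i=1,2$. Then $$\frac{\delta^2\mathscr I}{\delta\mu^2}(\mu;\nu_1,\nu_2):=\lim_{\epsilon\to0}\frac1\epsilon\Big\{\frac{\delta\mathscr I}{\delta\mu}(\mu+\epsilon\nu_2;\nu_1)-\frac{\delta\mathscr I}{\delta\mu}(\mu;\nu_1)\Big\}=\frac12\big\langle f_1,\ \mathscr L_{H_\mu}(-\mathscr L^s_{H_\mu})^{-1}\mathscr L^*_{H_\mu}f_2\big\rangle_\mu,$$ where $f_i=d\nu_i/d\mu$, that is $f_i(x)=\nu_i(x)/\mu(x)$.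
   Context: The generator is $(\mathscr Lf)(x)=\sum_yR(x,y)[f(y)-f(x)]$. For a probability measure $\mu$ on $V$, $\mathscr I(\mu)=\sup_{H:V\to\mathbb R}\mathscr J_H(\mu)$, where $\mathscr J_H(\mu)=\sum_{x,y}\mu(x)R(x,y)[1-e^{H(y)-H(x)}]$. Known fact: if the chain is irreducible and $\mu(x)>0$ for all $x$, there is a function $H_\mu:V\to\mathbb R$, unique up to an additive constant, such that $\mathscr I(\mu)=\mathscr J_{H_\mu}(\mu)$; this defines $H_\mu$. The first functional derivative is $\frac{\delta\mathscr I}{\delta\mu}(\mu;\nu)=\lim_{\epsilon\to0}\frac1\epsilon\{\mathscr I(\mu+\epsilon\nu)-\mathscr I(\mu)\}$ for $\nu:V\to\mathbb R$ with $\sum_x\nu(x)=0$. For $H:V\to\mathbb R$, $\mathscr L_H$ is the generator with jump rates $R_H(x,y)=R(x,y)e^{H(y)-H(x)}$. $\langle f,g\rangle_\mu=\sum_x\mu(x)f(x)g(x)$; $\mathscr L^*_{H_\mu}$ is the adjoint of $\mathscr L_{H_\mu}$ in $L^2(\mu)$, and $\mathscr L^s_{H_\mu}=\frac12(\mathscr L_{H_\mu}+\mathscr L^*_{H_\mu})$. (It is known that $\mu$ is stationary for $\mathscr L_{H_\mu}$.) The operator $-\mathscr L^s_{H_\mu}$ is invertible on the space of functions with $\mu$-mean zero, to which $\mathscr L^*_{H_\mu}f_2$ belongs; $(-\mathscr L^s_{H_\mu})^{-1}$ denotes this inverse. *)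

(* Defs.v *)
From HB Require Import structures.
From mathcomp Require Export all_boot all_order all_algebra.
From mathcomp Require Export all_classical all_reals all_analysis.

Set Implicit Arguments.
Unset Strict Implicit.
Unset Printing Implicit Defensive.

Import Order.TTheory GRing.Theory Num.Theory.
Import numFieldNormedType.Exports.

Local Open Scope classical_set_scope.
Local Open Scope ring_scope.

Section DonskerVaradhan.
Context {R : realType} {V : finType}.
Implicit Types (r : V -> V -> R) (mu nu f g H : V -> R).
Implicit Type A : (V -> R) -> (V -> R).

(** The diagonal entries [r x x] are left unconstrained: they cancel in [gen]
    and in [JH], so both conventions for them are covered. *)
Definition jump_rates r : Prop := forall x y, x != y -> 0 <= r x y.

Definition irreducible_rates r : Prop :=
  forall x y, connect (fun x y : V => 0 < r x y) x y.

Definition gen r f : V -> R := fun x => \sum_y r x y * (f y - f x).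

Definition JH r H mu : R :=
  \sum_x \sum_y mu x * r x y * (1 - expR (H y - H x)).

(** When [mu] is nonnegative, [JH r H mu] is bounded above uniformly in [H] by
    the total jump rate, so this supremum in [R] is a genuine one. *)
Definition DV r mu : R := sup [set JH r H mu | H in [set: V -> R]].

Definition DV_quotient r mu nu : R -> R :=
  fun e => e^-1 * (DV r (mu + e *: nu) - DV r mu).

Definition dDV r mu nu : R := lim (DV_quotient r mu nu e @[e --> 0^']).

(** The optimiser [H_mu] is unique only up to an additive constant; [Hopt] picks
    one representative, and [tilt r (Hopt r mu)] depends only on its class. *)
Definition Hopt r mu : V -> R := xget 0 [set H | DV r mu = JH r H mu].

Definition tilt r H : V -> V -> R := fun x y => r x y * expR (H y - H x).

Definition inner mu f g : R := \sum_x mu x * f x * g x.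

(** For positive [mu] and linear [A] exactly one such [h] exists for each [g]. *)
Definition adjoint mu A : (V -> R) -> (V -> R) :=
  fun g => xget 0 [set h | forall f, inner mu (A f) g = inner mu f h].

Definition sym_part mu A : (V -> R) -> (V -> R) :=
  fun f => 2^-1 *: (A f + adjoint mu A f).

(** Inverse of [A] on the functions of [mu]-mean zero. *)
Definition inv_mean0 mu A : (V -> R) -> (V -> R) :=
  fun h => xget 0 [set g | \sum_x mu x * g x = 0 /\ A g = h].

End DonskerVaradhan.

(* Main.v *)
(** The derivative of [DV] at [mu] in the direction [nu] is [JH_H nu] for an
    optimal [H] (envelope theorem), so the second derivative only requires the
    derivative of the optimiser. Optimality of [H] at [mu] says that the flow
    [c = mu * tilt r H] satisfies [sum c * grad g = 0] for every [g]. Comparing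
    these equations at [mu] and [mu + s nu2] and testing them against well-chosen
    [g] gives the optimisers' difference [u_s]: first [grad u_s = O(s)] (test
    with [u_s], using that [x * (exp x - 1)] is coercive), then
    [grad u_s = s * grad k + O(s ^+ 2)] (test with [u_s - s k]), where [k] solves
    the linearised equation [sum c * grad f * grad k = - sum d * grad f], with
    [d = nu2 * tilt r H]. As [mu] is stationary for [L_H], this reads
    [k = - 1/2 (- L^s)^-1 L^* f2]. No implicit function theorem is needed.
    Existence of the optimiser and of [k] come from minimising a functional of
    the gradient that is coercive thanks to irreducibility. *)
Require Import Defs.
From mathcomp Require Import ring lra.
Import Order.TTheory GRing.Theory Num.Theory.
Import numFieldNormedType.Exports.
Local Open Scope classical_set_scope.
Local Open Scope ring_scope.

Set Implicit Arguments.
Unset Strict Implicit.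

(** * Elementary bounds on the exponential *)

Section ExpInequalities.
Context {R : realType}.
Implicit Types (t : R).

(** As [t] tends to minus infinity, [t * (expR t - 1)] grows only linearly, hence the factor
    [1 + |t|]. For [t < 0] the bound comes from [expR t <= 1 / (1 - t)]. *)
Lemma sqr_le_mul_expRB1 t : t ^+ 2 <= (1 + `|t|) * (t * (expR t - 1)).
Proof.
have h := expR_ge1Dx t; have h' := expR_ge1Dx (- t); have e := expRxMexpNx_1 t.
have p := expR_gt0 t; have p' := expR_gt0 (- t).
case: (lerP 0 t) => t0; rewrite ?(ger0_norm t0) ?(ltr0_norm t0); first nra.
have : expR t * (1 - t) <= 1 by rewrite -[leRHS]e ler_pM2l.
nra.
Qed.

(** [expR t] lies between [1 + t] and [1 / (1 - t)], whose gap [t ^+ 2 / (1 - t)] is at most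
    [2 * t ^+ 2] in this range. *)
Lemma expR_remainder t : `|t| <= 2^-1 -> `|expR t - 1 - t| <= 2 * t ^+ 2.
Proof.
rewrite ler_norml => /andP[t1 t2].
have h := expR_ge1Dx t; have h' := expR_ge1Dx (- t); have e := expRxMexpNx_1 t.
have p := expR_gt0 t.
have : expR t * (1 - t) <= 1 by rewrite -[leRHS]e ler_pM2l.
rewrite ler_norml => q; apply/andP; split; nra.
Qed.

Lemma expRB1_norm t : `|t| <= 2^-1 -> `|expR t - 1| <= 2 * `|t|.
Proof.
move=> t12; have h := expR_remainder t12.
have -> : expR t - 1 = (expR t - 1 - t) + t by ring.
apply: (le_trans (ler_normD _ _)).
have : t ^+ 2 <= 2^-1 * `|t| by rewrite -real_normK ?num_real// expr2 ler_wpM2r.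
lra.
Qed.

End ExpInequalities.

(** * Critical points of weighted sums of exponentials *)

Section WeightedSums.
Context {R : realType} {I : finType}.
Implicit Types (c d t k n v : I -> R).

Lemma linear_coef_eq0 (a b del : R) : 0 < del ->
  (forall s, `|s| <= del -> 0 <= s * a + s ^+ 2 * b) -> a = 0.
Proof.
move=> del0 h; apply/eqP/negPn/negP => a0.
(* The test point is [s = - a / D] with this sum as [D]: the first summand keeps [|s| <= del], the
   others give [|b| / D < 1], so the linear term wins. *)
have D0 : 0 < `|a| / del + `|b| + 1.
  by rewrite ltr_wpDl// addr_ge0// divr_ge0// ltW.
set D := (X in 0 < X) in D0.
have iD0 : 0 < D^-1 by rewrite invr_gt0.
have aD : `|a| / del + `|b| + 1 = D by [].
have bD : `|D^-1 * b| < 1.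
  rewrite normrM gtr0_norm// mulrC ltr_pdivrMr// mul1r.
  by rewrite -aD addrAC ltrDr ltr_wpDl// divr_ge0// ltW.
have sd : `|- (D^-1 * a)| <= del.
  rewrite normrN normrM gtr0_norm// mulrC ler_pdivrMr// mulrC -ler_pdivrMr//.
  by rewrite -aD -addrA lerDl addr_ge0.
have := h _ sd.
have -> : - (D^-1 * a) * a + (- (D^-1 * a)) ^+ 2 * b
  = - (D^-1 * a ^+ 2 * (1 - D^-1 * b)) by ring.
rewrite oppr_ge0 leNgt => /negP; apply.
apply: mulr_gt0; first by rewrite mulr_gt0// exprn_even_gt0.
by rewrite subr_gt0; exact: le_lt_trans (ler_norm _) bD.
Qed.

(** A first-order condition without differentiation: [expR_remainder] bounds the increment by a
    linear plus a quadratic term in [s], and [linear_coef_eq0] applies. *)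
Lemma exp_sum_critical c t : (forall i, 0 <= c i) ->
  (forall s, \sum_i c i <= \sum_i c i * expR (s * t i)) ->
  \sum_i c i * t i = 0.
Proof.
move=> c0 h; pose T := 1 + \sum_i `|t i|.
have T0 : 0 < T by rewrite ltr_pwDl// sumr_ge0.
have tT i : `|t i| <= T.
  rewrite /T (bigD1 i)//= addrCA lerDl addr_ge0// sumr_ge0//.
pose b := \sum_i c i * (2 * t i ^+ 2).
apply: (@linear_coef_eq0 _ b ((2 * T)^-1)); first by rewrite invr_gt0 mulr_gt0.
move=> s sT; have := h s; rewrite -subr_ge0 -sumrB => /le_trans; apply.
rewrite /b !mulr_sumr -big_split/=; apply: ler_sum => i _.
have st : `|s * t i| <= 2^-1.
  have -> : 2^-1 = (2 * T)^-1 * T :> R by field; rewrite gt_eqF.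
  by rewrite normrM ler_pM.
have := expR_remainder st; rewrite ler_norml => /andP[_ st2].
have -> : c i * expR (s * t i) - c i = c i * (expR (s * t i) - 1) by ring.
have -> : s * (c i * t i) + s ^+ 2 * (c i * (2 * t i ^+ 2)) =
  c i * (s * t i + 2 * (s * t i) ^+ 2) by ring.
by rewrite ler_wpM2l//; lra.
Qed.

(* Sum the inequality [2 k |v i| <= v i ^+ 2 + k ^+ 2] and take [k = B]. *)
Lemma sqr_sum_absorb c v (B : R) : (forall i, 0 <= c i) -> 0 <= B ->
  \sum_i c i * v i ^+ 2 <= B * \sum_i c i * `|v i| ->
  \sum_i c i * `|v i| <= B * \sum_i c i.
Proof.
move=> c0 B0 h; set S := \sum_i c i * `|v i| in h *; set C := \sum_i c i.
have S0 : 0 <= S by apply: sumr_ge0 => i _; rewrite mulr_ge0.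
have key (k : R) : 2 * k * S <= B * S + k ^+ 2 * C.
  apply: (@le_trans _ _ (\sum_i c i * v i ^+ 2 + k ^+ 2 * C)); last by rewrite lerD2r.
  rewrite /S /C !mulr_sumr -big_split/=; apply: ler_sum => i _.
  have -> : 2 * k * (c i * `|v i|) = c i * (2 * k * `|v i|) by ring.
  have -> : c i * v i ^+ 2 + k ^+ 2 * c i = c i * (`|v i| ^+ 2 + k ^+ 2).
    by rewrite real_normK ?num_real//; ring.
  rewrite ler_wpM2l//.
  by have := sqr_ge0 (`|v i| - k); nra.
move: B0; rewrite le_eqVlt => /orP[/eqP B0|B0]; last first.
  have := key B; rewrite -subr_ge0.
  have -> : B * S + B ^+ 2 * C - 2 * B * S = B * (B * C - S) by ring.
  by rewrite pmulr_rge0// subr_ge0.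
(* For [B = 0] the choice [k = B] gives nothing, but [key] for all [k] bounds a linear term by a
   quadratic one, which forces [S = 0]. *)
rewrite -B0 mul0r leNgt; apply/negP => Sp.
suff /eqP : 2 * S = 0 by rewrite mulf_eq0 pnatr_eq0/= gt_eqF.
apply: (@linear_coef_eq0 _ C 1) => // s _.
have := key (- s); rewrite -B0 mul0r add0r sqrrN; nra.
Qed.

(* [0] is a critical point for the weights [c], [t] one for the perturbed [c']. *)
Lemma critical_point_lipschitz c c' t (eta : R) : (forall i, 0 <= c i) ->
  0 <= eta -> eta <= 8^-1 -> (forall i, `|c' i - c i| <= eta * c i) ->
  \sum_i c i * t i = 0 -> \sum_i c' i * expR (t i) * t i = 0 ->
  \sum_i c i * `|t i| <= 16 * eta * \sum_i c i.
Proof.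
move=> c0 eta0 eta8 cc' ct c't.
set S := \sum_i c i * `|t i|; set C := \sum_i c i.
(* The first bound is the difference of the two critical equations, the second is termwise
   coercivity. Together they give [2 * eta * S <= 32 * eta ^+ 2 * C]. *)
have [le1 le2] : \sum_i c' i * (t i * (expR (t i) - 1)) <= eta * S /\
   4 * eta * S <= \sum_i c' i * (2 * (t i * (expR (t i) - 1))) + 32 * eta ^+ 2 * C.
  split.
    have -> : \sum_i c' i * (t i * (expR (t i) - 1)) = - \sum_i (c' i - c i) * t i.
      apply/eqP; rewrite -addr_eq0 -big_split/=; apply/eqP.
      transitivity (\sum_i c' i * expR (t i) * t i - \sum_i c i * t i).
        by rewrite -sumrB; apply: eq_bigr => i _; ring.
      by rewrite c't ct subrr.
    apply: (le_trans (ler_norm _)); rewrite normrN.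
    apply: (le_trans (ler_norm_sum _ _ _)); rewrite mulr_sumr.
    by apply: ler_sum => i _; rewrite normrM mulrA ler_wpM2r.
  rewrite !mulr_sumr -big_split/=; apply: ler_sum => i _.
  have c2 : c i <= 2 * c' i.
    have := cc' i; rewrite ler_norml => /andP[+ _].
    have := c0 i; nra.
  set q := t i * (expR (t i) - 1); have := sqr_le_mul_expRB1 (t i); rewrite -/q.
  rewrite -[t i ^+ 2]real_normK ?num_real//; have := normr_ge0 (t i).
  move: `|t i| => x x0 xq.
  have q0 : 0 <= q by have := sqr_ge0 x; nra.
  have -> : c' i * (2 * q) = 2 * c' i * q by ring.
  apply: (@le_trans _ _ (c i * q + 32 * eta ^+ 2 * c i)); last first.
    by rewrite lerD2r ler_wpM2r.
  have -> : 4 * eta * (c i * x) = c i * (4 * eta * x) by ring.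
  have -> : c i * q + 32 * eta ^+ 2 * c i = c i * (q + 32 * eta ^+ 2) by ring.
  rewrite ler_wpM2l//.
  (* Below this threshold [32 * eta ^+ 2] dominates [4 * eta * x]; above it
     [q >= x ^+ 2 / (1 + x) >= 4 * eta * x], because [8 * eta <= 1]. *)
  have [xe|xe] := lerP x (8 * eta); first nra.
  apply: le_trans (_ : q <= _); last by rewrite lerDl mulr_ge0// sqr_ge0.
  have x1 : 0 < 1 + x by lra.
  rewrite -(ler_pM2l x1); apply: le_trans xq; nra.
have : \sum_i c' i * (2 * (t i * (expR (t i) - 1))) =
    2 * \sum_i c' i * (t i * (expR (t i) - 1)).
  by rewrite mulr_sumr; apply: eq_bigr => i _; ring.
move=> e; rewrite e in le2.
have key : 2 * eta * S <= 32 * eta ^+ 2 * C by lra.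
move: eta0; rewrite le_eqVlt => /orP[/eqP e0|e0]; last first.
  have e2 : 0 < 2 * eta by lra.
  by rewrite -(ler_pM2l e2); apply: le_trans key _; rewrite le_eqVlt; apply/orP; left; apply/eqP; ring.
(* For [eta = 0] one cannot divide by [eta]: here [c' = c], and a vanishing sum of nonnegative terms
   forces [t i = 0] wherever [c i] is nonzero. *)
have c'c i : c' i = c i.
  apply/eqP; rewrite -subr_eq0 -normr_le0; apply: le_trans (cc' i) _.
  by rewrite -e0 mul0r.
have q0 i : 0 <= t i * (expR (t i) - 1).
  by have := sqr_le_mul_expRB1 (t i); have := sqr_ge0 (t i); have := normr_ge0 (t i); nra.
have S0 : \sum_i c' i * (t i * (expR (t i) - 1)) = 0.
  apply/eqP; rewrite eq_le; apply/andP; split; first by rewrite -e0 mul0r in le1.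
  by apply: sumr_ge0 => i _; rewrite c'c mulr_ge0.
rewrite -e0 mulr0 mul0r /S big1// => i _.
have /eqP : c' i * (t i * (expR (t i) - 1)) = 0.
  by apply: (psumr_eq0P _ S0) => // j _; rewrite c'c mulr_ge0.
rewrite c'c mulf_eq0 => /orP[/eqP->|/eqP ti]; first by rewrite mul0r.
have := sqr_le_mul_expRB1 (t i); rewrite ti mulr0 => t2.
have /eqP : t i ^+ 2 = 0 by apply/eqP; rewrite eq_le t2 sqr_ge0.
by rewrite sqrf_eq0 => /eqP->; rewrite normr0 mulr0.
Qed.

End WeightedSums.

(** * First-order expansion of a perturbed critical point *)

Section WeightedExpansions.
Context {R : realType} {I : finType}.
Implicit Types (c d t k n a : I -> R).

(** Turns a bound on a weighted sum into a pointwise one, with a constant uniform in [i]; zero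
    weights add nothing to it since [0^-1 = 0]. *)
Lemma term_le_weighted_sum c a i : (forall j, 0 <= c j) -> (forall j, 0 <= a j) ->
  0 < c i -> a i <= (\sum_j (c j)^-1) * \sum_j c j * a j.
Proof.
move=> c0 a0 ci.
have -> : a i = (c i)^-1 * (c i * a i) by rewrite mulrA mulVf ?mul1r// gt_eqF.
apply: ler_pM; rewrite ?invr_ge0 ?mulr_ge0//.
- by rewrite (bigD1 i)//= lerDl sumr_ge0// => j _; rewrite invr_ge0.
- by rewrite (bigD1 i)//= lerDl sumr_ge0// => j _; rewrite mulr_ge0.
Qed.

Lemma dominated_sum_le c n a (M B : R) : (forall i, 0 <= c i) ->
  (forall i, `|n i| <= M * c i) -> (forall i, 0 < c i -> `|a i| <= B) ->
  `|\sum_i n i * a i| <= M * (B * \sum_i c i).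
Proof.
move=> c0 nM aB; apply: le_trans (ler_norm_sum _ _ _) _.
rewrite !mulr_sumr; apply: ler_sum => i _; rewrite normrM.
have := c0 i; rewrite le_eqVlt => /orP[/eqP ci|ci].
  have := nM i; rewrite -ci mulr0 normr_le0 => /eqP->.
  by rewrite normr0 mul0r !mulr0.
have -> : M * (B * c i) = M * c i * B by ring.
by apply: ler_pM => //; exact: aB.
Qed.

(** The three equations are two critical point equations and the linearised one, all tested against
    [v = t - s * k]. Combined, they leave [c * v ^+ 2] balanced against second-order errors times
    [v], which [sqr_sum_absorb] turns into a bound on [v]. *)
Lemma expansion_remainder c d t k (M s tau : R) : (forall i, 0 <= c i) ->
  0 <= M -> (forall i, `|d i| <= M * c i) -> 0 <= tau -> tau <= 2^-1 ->
  (forall i, 0 < c i -> `|t i| <= tau) ->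
  \sum_i c i * (t i - s * k i) = 0 ->
  \sum_i (c i + s * d i) * expR (t i) * (t i - s * k i) = 0 ->
  \sum_i c i * k i * (t i - s * k i) = - \sum_i d i * (t i - s * k i) ->
  \sum_i c i * `|t i - s * k i| <=
    (2 * tau ^+ 2 + 2 * `|s| * M * tau) * \sum_i c i.
Proof.
move=> c0 M0 dM tau0 tau2 ttau h1 h2 h3.
apply: sqr_sum_absorb => //; first by rewrite addr_ge0 ?mulr_ge0 ?sqr_ge0.
have -> : \sum_i c i * (t i - s * k i) ^+ 2 =
    - \sum_i (c i * (expR (t i) - 1 - t i) + s * d i * (expR (t i) - 1))
             * (t i - s * k i).
  transitivity (\sum_i c i * (t i - s * k i) ^+ 2
     + s * (\sum_i c i * k i * (t i - s * k i) + \sum_i d i * (t i - s * k i))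
     - \sum_i (c i + s * d i) * expR (t i) * (t i - s * k i)
     + \sum_i c i * (t i - s * k i)).
    by rewrite h1 h2 h3 addNr mulr0; ring.
  rewrite -!sumrN -!big_split/= mulr_sumr -!big_split/=.
  by apply: eq_bigr => i _; ring.
apply: le_trans (ler_norm _) _; rewrite normrN.
apply: le_trans (ler_norm_sum _ _ _) _; rewrite mulr_sumr.
apply: ler_sum => i _; rewrite normrM mulrA ler_wpM2r//.
have := c0 i; rewrite le_eqVlt => /orP[/eqP ci|ci].
  have := dM i; rewrite -ci mulr0 normr_le0 => /eqP->.
  by rewrite mul0r !mulr0 mul0r addr0 normr0.
have ti := ttau _ ci; have ti2 := le_trans ti tau2.
have tt : `|t i| ^+ 2 <= tau ^+ 2 by rewrite ler_sqr ?nnegrE.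
have e1 : `|expR (t i) - 1 - t i| <= 2 * tau ^+ 2.
  by have := expR_remainder ti2; rewrite -(real_normK (num_real (t i))); lra.
have e2 : `|expR (t i) - 1| <= 2 * tau by have := expRB1_norm ti2; lra.
apply: le_trans (ler_normD _ _) _; rewrite !normrM (ger0_norm (c0 i)).
have -> : (2 * tau ^+ 2 + 2 * `|s| * M * tau) * c i =
  c i * (2 * tau ^+ 2) + `|s| * (M * c i) * (2 * tau) by ring.
by apply: lerD; [rewrite ler_wpM2l | rewrite ler_pM ?mulr_ge0// ler_wpM2l].
Qed.

(** Splits [expR t - 1 - s * k] into the Taylor remainder of [expR] and [t - s * k]. *)
Lemma exp_sum_expansion c n t k (M s tau B : R) : (forall i, 0 <= c i) ->
  (forall i, `|n i| <= M * c i) -> tau <= 2^-1 -> 0 <= M ->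
  (forall i, 0 < c i -> `|t i| <= tau) ->
  \sum_i c i * `|t i - s * k i| <= B * \sum_i c i ->
  `|\sum_i n i * (expR (t i) - 1) - s * \sum_i n i * k i| <=
    M * ((2 * tau ^+ 2 + B) * \sum_i c i).
Proof.
move=> c0 nM tau2 M0 ttau vB.
have -> : \sum_i n i * (expR (t i) - 1) - s * \sum_i n i * k i =
    \sum_i n i * (expR (t i) - 1 - t i) + \sum_i n i * (t i - s * k i).
  by rewrite mulr_sumr -sumrB -big_split/=; apply: eq_bigr => i _; ring.
apply: le_trans (ler_normD _ _) _; rewrite mulrDl mulrDr lerD//.
  apply: dominated_sum_le => // i ci.
  have ti := ttau _ ci; have ti2 := le_trans ti tau2.
  have tt : `|t i| ^+ 2 <= tau ^+ 2 by rewrite ler_sqr ?nnegrE// (le_trans _ ti).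
  by have := expR_remainder ti2; rewrite -(real_normK (num_real (t i))); lra.
apply: le_trans (ler_norm_sum _ _ _) _; apply: le_trans (ler_wpM2l M0 vB).
rewrite mulr_sumr; apply: ler_sum => i _.
by rewrite normrM mulrA ler_wpM2r.
Qed.

End WeightedExpansions.

(** * Minimisers of functionals of the gradient *)

Section Argmin.
Context {R : realType} {V : finType}.
Implicit Types (r : V -> V -> R) (H G : V -> R).

Definition grad H (p : V * V) : R := H p.2 - H p.1.

Lemma gradDZ (s : R) G H p : grad (G + s *: H) p = grad G p + s * grad H p.
Proof. by rewrite /grad !fctE /GRing.scale/=; ring. Qed.

(** Telescoping along a duplicate-free path, which has at most [#|V|] edges. Exchanging [x] and [y]
    makes the one-sided bound two-sided. *)
Lemma grad_le_connected r (M : R) H x y : irreducible_rates r -> 0 <= M ->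
  (forall p, 0 < r p.1 p.2 -> grad H p <= M) -> H y - H x <= #|V|%:R * M.
Proof.
move=> irr M0 HM; have /connectP[q pq ->] := irr x y.
case/shortenP: pq => {}q pq uq _.
have szq : (size q <= #|V|)%N.
  by have := max_card (mem (x :: q)); rewrite (card_uniqP uq)/=; apply: leq_trans.
apply: (@le_trans _ _ ((size q)%:R * M)); last by rewrite ler_wpM2r// ler_nat.
elim: q x pq {uq szq} => [|z q IH] x /=; first by rewrite subrr mul0r.
move=> /andP[rxz /IH]; have := HM (x, z) rxz; rewrite /grad/= -natr1; lra.
Qed.

(* Tychonoff on a cube: only gradients enter, so one may normalise [H x0 = 0]
   and then irreducibility bounds every [H x]. *)
Lemma exists_argmin r (phi : V * V -> R -> R) (M : R) :
  irreducible_rates r -> 0 <= M -> (forall p, continuous (phi p)) ->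
  (forall H, \sum_p phi p (grad H p) <= \sum_p phi p 0 ->
     forall p, 0 < r p.1 p.2 -> grad H p <= M) ->
  exists H, forall G, \sum_p phi p (grad H p) <= \sum_p phi p (grad G p).
Proof.
move=> irr M0 phic HM.
have [x0 _|V0] := pickP V; last first.
  by exists 0 => G; rewrite !big1// => -[x y]; have := V0 x.
pose Phi (H : {ptws V -> R}) := \sum_p phi p (grad H p).
pose N : R := #|V|%:R * M.
have N0 : 0 <= N by rewrite mulr_ge0.
pose A : set {ptws V -> R} := [set H | forall x, `[- N, N]%classic (H x)].
have Ac : compact A.
  exact: (@tychonoff V (fun=> R) (fun=> `[- N, N]%classic) (fun=> @segment_compact R _ _)).
have evalc x : continuous (fun H : {ptws V -> R} => H x).
  exact: (@proj_continuous V (fun=> R)).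
have gradc p : continuous (fun H : {ptws V -> R} => grad H p).
  by move=> H; exact: (@cvgB _ _ _ _ _ _ _ _ _ (@evalc p.2 H) (@evalc p.1 H)).
have Phic : continuous Phi.
  apply: continuous_big => [|p _]; first exact: add_continuous.
  move=> H; exact: (@continuous_comp _ _ _ _ (phi p) H (@gradc p H) (@phic p _)).
have A0 : A (fun=> 0) by move=> x /=; rewrite in_itv/= oppr_le0 N0.
have [] := @compact_EVT_min _ R Phi A; first by exists (fun=> 0).
- exact: Ac.
- exact: continuous_subspaceT.
move=> H _ Hmin; exists H => G.
have Phi0 : Phi (fun=> 0) = \sum_p phi p 0.
  by apply: eq_bigr => p _; rewrite /grad subrr.
(* A competitor with more energy than the zero function is beaten by it, and zero lies in the cube;
   any other satisfies the a priori bound. *)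
have [G0|G0] := lerP (\sum_p phi p (grad G p)) (\sum_p phi p 0); last first.
  apply: le_trans (ltW G0); rewrite -Phi0; apply: Hmin.
  by rewrite inE.
pose G' : {ptws V -> R} := fun x => G x - G x0.
have GG' : \sum_p phi p (grad G p) = Phi G'.
  by apply: eq_bigr => p _; congr phi; rewrite /grad/G'; ring.
rewrite GG'; apply: Hmin; rewrite inE => x /=; rewrite in_itv/=.
have hM := HM _ G0.
have := grad_le_connected x0 x irr M0 hM; have := grad_le_connected x x0 irr M0 hM.
rewrite -/N /G' => h1 h2; apply/andP; split; lra.
Qed.

End Argmin.

(** * The linearised equation *)

Section WeakSolution.
Context {R : realType} {V : finType}.

(** This is the Euler-Lagrange equation of the sum of [c * grad g ^+ 2 - 2 * d * grad g]. Domination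
    of [d] by [c] makes this functional coercive through [sqr_sum_absorb]. *)
Lemma exists_weak_solution (r : V -> V -> R) (c d : V * V -> R) (M : R) :
  irreducible_rates r -> 0 <= M -> (forall p, 0 <= c p) ->
  (forall p, 0 < r p.1 p.2 -> 0 < c p) -> (forall p, `|d p| <= M * c p) ->
  exists g : V -> R, forall f : V -> R,
    \sum_p c p * grad f p * grad g p = \sum_p d p * grad f p.
Proof.
move=> irr M0 c0 rc dM.
pose phi p (t : R) : R := c p * t ^+ 2 - 2 * d p * t.
have [|p|H HH|g gmin] := @exists_argmin R V r phi
    ((\sum_p (c p)^-1) * (2 * M * \sum_p c p)) irr.
- by rewrite !mulr_ge0// sumr_ge0// => i _; rewrite ?invr_ge0.
- move=> x; apply: cvgB.
    by apply: cvgM; [exact: cvg_cst | exact: exprn_continuous].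
  by apply: cvgM; [exact: cvg_cst | exact: cvg_id].
- move=> p rp; apply: le_trans (ler_norm _) _.
  have := @term_le_weighted_sum _ _ c (fun p => `|grad H p|) p c0 _ (rc _ rp).
  move=> /(_ (fun=> normr_ge0 _))/le_trans; apply.
  rewrite ler_wpM2l ?sumr_ge0// => [i _|]; first by rewrite invr_ge0.
  apply: sqr_sum_absorb; rewrite ?mulr_ge0//.
  apply: (@le_trans _ _ (\sum_p 2 * d p * grad H p)).
    rewrite -subr_le0 -sumrB; apply: le_trans HH _.
    by rewrite big1// => q _; rewrite /phi expr0n/= !mulr0 subrr.
  rewrite mulr_sumr; apply: ler_sum => q _; apply: le_trans (ler_norm _) _.
  have -> : 2 * M * (c q * `|grad H q|) = 2 * (M * c q) * `|grad H q| by ring.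
  by rewrite !normrM ler_wpM2r// ger0_norm// ler_wpM2l.
exists g => f; apply/eqP; rewrite -subr_eq0; apply/eqP.
apply: (@linear_coef_eq0 _ _ (2^-1 * \sum_p c p * grad f p ^+ 2) 1) => // s _.
have := gmin (g + s *: f); rewrite -subr_ge0 -sumrB.
rewrite -(@pmulr_rge0 _ 2^-1)// => /le_trans; apply.
rewrite -sumrB !mulr_sumr -big_split/=; apply: ler_sum => p _.
by rewrite gradDZ /phi le_eqVlt; apply/orP; left; apply/eqP; field.
Qed.

End WeakSolution.

(** * Optimisers of the rate functional and their dependence on the measure *)

Section Optimizers.
Context {R : realType} {V : finType}.
Variable r : V -> V -> R.
Hypotheses (r_ge0 : forall x y, 0 <= r x y) (r_irr : irreducible_rates r).
Implicit Types (mu nu f g H : V -> R).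

Definition flux mu H (p : V * V) : R := mu p.1 * tilt r H p.1 p.2.

Lemma JH_flux H mu : JH r H mu = \sum_p flux mu 0 p - \sum_p flux mu H p.
Proof.
rewrite /JH pair_bigA/= -sumrB; apply: eq_bigr => p _.
by rewrite /flux /tilt subrr expR0; ring.
Qed.

Lemma flux_ge0 mu H p : (forall x, 0 < mu x) -> 0 <= flux mu H p.
Proof. by move=> mu0; rewrite !mulr_ge0 ?expR_ge0// ltW. Qed.

Lemma flux_gt0 mu H p : (forall x, 0 < mu x) -> 0 < r p.1 p.2 -> 0 < flux mu H p.
Proof. by move=> mu0 rp; rewrite !mulr_gt0 ?expR_gt0. Qed.

Lemma flux_norm_le mu nu H (M : R) p : (forall x, `|nu x| <= M * mu x) ->
  `|flux nu H p| <= M * flux mu H p.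
Proof.
move=> nuM; rewrite normrM mulrA (@ger0_norm _ (tilt _ _ _ _)); last first.
  by rewrite mulr_ge0 ?expR_ge0.
by rewrite ler_wpM2r// mulr_ge0 ?expR_ge0.
Qed.

(** Brings perturbed flows to the shape [(c + s * d) * expR t] of the abstract estimates, with [t]
    the gradient of [H' - H]. *)
Lemma flux_line mu nu H H' (s : R) p :
  flux (mu + s *: nu) H' p =
  (flux mu H p + s * flux nu H p) * expR (grad (H' - H) p).
Proof.
rewrite /flux /tilt/= !fctE.
have -> : H' p.2 - H' p.1 = (H p.2 - H p.1) + grad (H' - H) p.
  by rewrite /grad !fctE; ring.
by rewrite expRD /GRing.scale/=; ring.
Qed.

Lemma JH_le_DV mu H : (forall x, 0 < mu x) -> JH r H mu <= DV r mu.
Proof.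
move=> mu0; apply: ub_le_sup; last by exists H.
exists (\sum_p flux mu 0 p) => _ [G _ <-].
by rewrite JH_flux lerBlDr lerDl sumr_ge0// => p _; exact: flux_ge0.
Qed.

(** By [JH_flux], maximising [JH] means minimising the total flow. A single term
    [c p * expR (grad H p)] bounded by the total yields the gradient bound. *)
Lemma exists_optimizer mu : (forall x, 0 < mu x) ->
  exists H, DV r mu = JH r H mu.
Proof.
move=> mu0; pose c := flux mu 0.
have c0 p : 0 <= c p by exact: flux_ge0.
have fluxE H p : flux mu H p = c p * expR (grad H p).
  by rewrite /c /flux /tilt subrr expR0 mulr1 mulrA.
have [|p|H HH|H Hmin] := @exists_argmin R V r (fun p t => c p * expR t)
    ((\sum_p (c p)^-1) * \sum_p c p) r_irr.
- by rewrite !mulr_ge0// sumr_ge0// => i _; rewrite ?invr_ge0.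
- by move=> x; apply: cvgM; [exact: cvg_cst | exact: continuous_expR].
- move=> p rp; apply: (@le_trans _ _ (expR (grad H p))).
    by have := expR_ge1Dx (grad H p); lra.
  have := @term_le_weighted_sum _ _ c (fun p => expR (grad H p)) p c0 _ _.
  move=> /(_ (fun=> expR_ge0 _) (flux_gt0 _ mu0 rp))/le_trans; apply.
  rewrite ler_wpM2l ?sumr_ge0// => [i _|]; first by rewrite invr_ge0.
  by apply: le_trans HH _; apply: ler_sum => q _; rewrite expR0 mulr1.
exists H; apply/eqP; rewrite eq_le JH_le_DV// andbT.
apply: ge_sup; first by exists (JH r H mu), H.
move=> _ [G _ <-]; rewrite !JH_flux lerD2l lerN2.
by under eq_bigr do rewrite fluxE; under [leRHS]eq_bigr do rewrite fluxE.
Qed.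

Lemma optimizer_critical mu H g : (forall x, 0 < mu x) ->
  DV r mu = JH r H mu -> \sum_p flux mu H p * grad g p = 0.
Proof.
move=> mu0 HH; apply: exp_sum_critical => [p|s]; first exact: flux_ge0.
have := JH_le_DV (H + s *: g) mu0; rewrite HH !JH_flux lerD2l lerN2.
move/le_trans; apply; apply: ler_sum => p _.
rewrite -[mu in flux mu (_ + _)]addr0 -[X in mu + X](scale0r mu) (flux_line _ _ H).
have -> : grad (H + s *: g - H) p = s * grad g p.
  by rewrite addrAC subrr gradDZ [grad 0 p]subrr add0r.
by rewrite mul0r addr0.
Qed.

Lemma JHD mu nu H (s : R) : JH r H (mu + s *: nu) = JH r H mu + s * JH r H nu.
Proof.
rewrite /JH mulr_sumr -big_split/=; apply: eq_bigr => x _.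
rewrite mulr_sumr -big_split/=; apply: eq_bigr => y _.
by rewrite !fctE /GRing.scale/=; ring.
Qed.

Lemma JHB nu H H' :
  JH r H' nu - JH r H nu = - \sum_p flux nu H p * (expR (grad (H' - H) p) - 1).
Proof.
rewrite !JH_flux -[RHS]sumrN.
transitivity (\sum_p flux nu H p - \sum_p flux nu H' p); first by ring.
rewrite -sumrB; apply: eq_bigr => p _.
rewrite -[nu in flux nu H']addr0 -[X in nu + X](scale0r nu) (flux_line _ _ H).
by ring.
Qed.

Lemma norm_le_density nu mu x : (forall x, 0 < mu x) ->
  `|nu x| <= (\sum_y `|nu y| / mu y) * mu x.
Proof.
move=> mu0; rewrite -ler_pdivrMr// (bigD1 x)//= lerDl sumr_ge0// => y _.
by rewrite divr_ge0// ltW.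
Qed.

Lemma flux_dominated mu nu H p : (forall x, 0 < mu x) ->
  `|flux nu H p| <= (\sum_x `|nu x| / mu x) * flux mu H p.
Proof. by move=> mu0; apply: flux_norm_le => x; exact: norm_le_density. Qed.

Lemma optimizer_lipschitz mu nu H : (forall x, 0 < mu x) -> DV r mu = JH r H mu ->
  exists K delta : R, [/\ 0 <= K, 0 < delta & forall s, `|s| < delta ->
    [/\ forall x, 0 < (mu + s *: nu) x, K * `|s| <= 2^-1
      & forall H', DV r (mu + s *: nu) = JH r H' (mu + s *: nu) ->
        forall p, 0 < flux mu H p -> `|grad (H' - H) p| <= K * `|s|]].
Proof.
move=> mu0 HH.
pose M := \sum_x `|nu x| / mu x.
have M0 : 0 <= M by apply: sumr_ge0 => x _; rewrite divr_ge0// ltW.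
have nuM x : `|nu x| <= M * mu x by exact: norm_le_density.
pose c := flux mu H.
have c0 p : 0 <= c p by exact: flux_ge0.
pose K := (\sum_p (c p)^-1) * (16 * M * \sum_p c p).
have K0 : 0 <= K by rewrite !mulr_ge0// sumr_ge0// => i _; rewrite ?invr_ge0.
(* The inverse of this sum is the radius: [8 * M] makes [eta = |s| * M] at most 1/8 and keeps
   [mu + s *: nu] positive, [2 * K] gives [K * |s| <= 1/2]. *)
have D0 : 0 < 8 * M + 2 * K + 1 by lra.
exists K, (8 * M + 2 * K + 1)^-1; split=> //; first by rewrite invr_gt0.
move=> s; rewrite -[ltRHS]mul1r ltr_pdivlMr// => sD.
have sM : 0 <= `|s| * M by rewrite mulr_ge0.
have sK : 0 <= `|s| * K by rewrite mulr_ge0.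
have s0 := normr_ge0 s.
have mus0 x : 0 < (mu + s *: nu) x.
  have : `|s * nu x| <= `|s| * M * mu x by rewrite normrM -mulrA ler_wpM2l.
  rewrite ler_norml => /andP[+ _].
  rewrite !fctE /GRing.scale/=; have := mu0 x; nra.
split=> //; first lra.
move=> H' H'opt p cp.
have := @term_le_weighted_sum _ _ c (fun p => `|grad (H' - H) p|) p c0 _ cp.
move=> /(_ (fun=> normr_ge0 _))/le_trans; apply.
rewrite -[leRHS]mulrA ler_wpM2l ?sumr_ge0// => [i _|]; first by rewrite invr_ge0.
have -> : 16 * M * (\sum_p c p) * `|s| = 16 * (`|s| * M) * \sum_p c p by ring.
apply: (@critical_point_lipschitz _ _ c (fun p => c p + s * flux nu H p)) => //.
- by lra.
- move=> q; rewrite addrAC subrr add0r normrM -mulrA ler_wpM2l//.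
  exact: flux_norm_le.
- exact: optimizer_critical.
- rewrite -[RHS](optimizer_critical (H' - H) mus0 H'opt).
  by apply: eq_bigr => q _; rewrite (flux_line _ _ H).
Qed.

Lemma cvg_linear_error (f : R -> R) (l K delta : R) : 0 < delta ->
  (forall s, s != 0 -> `|s| < delta -> `|f s - l| <= K * `|s|) ->
  f s @[s --> 0^'] --> l.
Proof.
move=> d0 fl; apply/subr_cvg0; apply: (cvg_to_0_linear d0) => s /andP[s0 sd].
by apply: fl; rewrite -?normr_gt0.
Qed.

(* [DV (mu + s nu) - DV mu] lies between [s JH_H nu] and [s JH_H' nu], where
   [H] and [H'] are optimal at [mu] and at [mu + s nu]. *)
Lemma cvg_DV_quotient mu nu H : (forall x, 0 < mu x) -> DV r mu = JH r H mu ->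
  DV_quotient r mu nu s @[s --> 0^'] --> JH r H nu.
Proof.
move=> mu0 HH; have [K [del [K0 del0 lip]]] := optimizer_lipschitz nu mu0 HH.
pose M := \sum_x `|nu x| / mu x.
pose C := M * (2 * K * \sum_p flux mu H p).
apply: (@cvg_linear_error _ _ C del) => // s s0 sd.
have [mus0 Ks ts] := lip s sd; have [H' H'opt] := exists_optimizer mus0.
set X := DV r (mu + s *: nu) - DV r mu - s * JH r H nu.
have X0 : 0 <= X.
  by have := JH_le_DV H mus0; rewrite JHD -HH /X; lra.
have XH : X <= s * (JH r H' nu - JH r H nu).
  by have := JH_le_DV H' mu0; rewrite /X H'opt JHD mulrBr; lra.
have HHC : `|JH r H' nu - JH r H nu| <= C * `|s|.
  rewrite JHB normrN.
  apply: le_trans (_ : M * (2 * (K * `|s|) * \sum_p flux mu H p) <= _).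
    apply: dominated_sum_le => [p|p|p cp]; first exact: flux_ge0.
      exact: flux_dominated.
    have tp := ts _ H'opt _ cp.
    by apply: le_trans (expRB1_norm (le_trans tp Ks)) _; rewrite ler_wpM2l.
  by rewrite /C le_eqVlt; apply/orP; left; apply/eqP; ring.
have -> : DV_quotient r mu nu s - JH r H nu = s^-1 * X.
  by rewrite /DV_quotient /X; field.
rewrite normrM normfV mulrC ler_pdivrMr ?normr_gt0// (ger0_norm X0).
apply: le_trans XH _; apply: le_trans (ler_norm _) _.
by rewrite normrM mulrC ler_wpM2r.
Qed.

Lemma inner_gen mu H f g :
  inner mu f (gen (tilt r H) g) = \sum_p flux mu H p * f p.1 * grad g p.
Proof.
rewrite -(pair_bigA _ (fun x y => flux mu H (x, y) * f x * grad g (x, y)))/=.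
apply: eq_bigr => x _; rewrite mulr_sumr; apply: eq_bigr => y _.
by rewrite /flux /grad/=; ring.
Qed.

Lemma innerC mu f g : inner mu f g = inner mu g f.
Proof. by apply: eq_bigr => x _; rewrite mulrAC. Qed.

Lemma inner_inj mu f g : (forall x, 0 < mu x) ->
  (forall h, inner mu h f = inner mu h g) -> f = g.
Proof.
move=> mu0 fg; apply/funext => x.
have := fg (fun y => (y == x)%:R); rewrite /inner (bigD1 x)//= [RHS](bigD1 x)//=.
rewrite eqxx mulr1 !big1 ?addr0 => [|y /negPf->|y /negPf->]; try by rewrite mulr0 mul0r.
by apply: mulfI; rewrite gt_eqF.
Qed.

Lemma adjoint_genP mu H f g : (forall x, 0 < mu x) ->
  inner mu f (adjoint mu (gen (tilt r H)) g) = inner mu (gen (tilt r H) f) g.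
Proof.
move=> mu0; rewrite /adjoint; set P := [set h | _].
suff /(xgetPex 0) : exists h, P h by rewrite /P/= => ->.
pose q x y := mu x * g x * tilt r H x y.
(* The forward operator: inflow minus outflow of the mass [mu * g], as a density with respect to
   [mu]. *)
exists (fun y => (\sum_x q x y - \sum_z q y z) / mu y) => u.
rewrite innerC inner_gen -(pair_bigA _ (fun x y => flux mu H (x, y) * g x * grad u (x, y)))/=.
transitivity (\sum_x \sum_y (q x y * u y - q x y * u x)).
  by apply: eq_bigr => x _; apply: eq_bigr => y _; rewrite /flux /grad /q/=; ring.
under eq_bigr do rewrite sumrB.
rewrite sumrB exchange_big/= -sumrB; apply: eq_bigr => x _.
by rewrite -!mulr_suml; field; rewrite gt_eqF.
Qed.

Lemma inner_sym_part mu H f g : (forall x, 0 < mu x) -> DV r mu = JH r H mu ->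
  inner mu f (sym_part mu (gen (tilt r H)) g) =
  - (2^-1 * \sum_p flux mu H p * grad f p * grad g p).
Proof.
move=> mu0 HH.
have -> : inner mu f (sym_part mu (gen (tilt r H)) g) =
    2^-1 * (inner mu f (gen (tilt r H) g) + inner mu g (gen (tilt r H) f)).
  rewrite [in RHS](innerC mu g) -(adjoint_genP H f g mu0) /inner -big_split mulr_sumr/=.
  by apply: eq_bigr => x _; rewrite /sym_part !fctE /GRing.scale/=; ring.
rewrite !inner_gen -mulrN; congr (_ * _).
(* Discrete product rule; the gradient of the product sums to zero by criticality, that is, by
   stationarity of [mu]. *)
transitivity (\sum_p flux mu H p * grad (fun x => f x * g x) p
              - \sum_p flux mu H p * grad f p * grad g p).
  by rewrite -sumrB -big_split/=; apply: eq_bigr => p _; rewrite /grad; ring.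
by rewrite (optimizer_critical _ mu0 HH) sub0r.
Qed.

(** Tested against all [f], the operator equation becomes a weak one, which [exists_weak_solution]
    solves; hence [xget] does not return its default. *)
Lemma inv_mean0_sym_part mu nu H : (forall x, 0 < mu x) -> \sum_x mu x = 1 ->
  DV r mu = JH r H mu ->
  let L := gen (tilt r H) in
  let g := inv_mean0 mu (fun g => - sym_part mu L g)
             (adjoint mu L (fun x => nu x / mu x)) in
  forall f, \sum_p flux mu H p * grad f p * grad g p =
            2 * \sum_p flux nu H p * grad f p.
Proof.
move=> mu0 mu1 HH L g.
have fluxE u : inner mu (fun x => nu x / mu x) (L u) = \sum_p flux nu H p * grad u p.
  by rewrite inner_gen; apply: eq_bigr => p _; rewrite /flux; field; rewrite gt_eqF.
have eqvE h : - sym_part mu L h = adjoint mu L (fun x => nu x / mu x) <->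
   forall f, \sum_p flux mu H p * grad f p * grad h p =
            2 * \sum_p flux nu H p * grad f p.
  have innerN u v : inner mu u (- v) = - inner mu u v.
    by rewrite /inner -sumrN; apply: eq_bigr => x _; rewrite !fctE mulrN.
  split=> [eqh f|weak].
    have := congr1 (inner mu f) eqh.
    rewrite innerN inner_sym_part// adjoint_genP// innerC fluxE opprK => <-.
    by rewrite mulrA divff ?mul1r.
  apply: (inner_inj mu0) => f.
  rewrite innerN inner_sym_part// adjoint_genP// innerC fluxE opprK weak.
  by rewrite mulrA mulVf ?mul1r.
suff : exists h, \sum_x mu x * h x = 0 /\
    - sym_part mu L h = adjoint mu L (fun x => nu x / mu x).
  by move=> /(xgetPex 0)[_ /eqvE].
have [|p|p|p|h hE] := @exists_weak_solution R V r (flux mu H)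
    (fun p => 2 * flux nu H p) (2 * \sum_x `|nu x| / mu x) r_irr.
- by rewrite mulr_ge0// sumr_ge0// => x _; rewrite divr_ge0// ltW.
- exact: flux_ge0.
- exact: flux_gt0.
- rewrite normrM ger0_norm// -mulrA ler_wpM2l//.
  exact: flux_dominated.
(* Centring leaves gradients unchanged and gives mean zero because [mu] has mass one. *)
exists (fun x => h x - \sum_y mu y * h y); split.
  under eq_bigr do rewrite mulrBr.
  by rewrite sumrB -mulr_suml mu1 mul1r subrr.
apply/eqvE => f; rewrite mulr_sumr.
under [RHS]eq_bigr do rewrite mulrA.
by rewrite -hE; apply: eq_bigr => p _; congr (_ * _); rewrite /grad; ring.
Qed.

(** Expands [JHB] with [grad u = s * grad k + O(s ^+ 2)], for an arbitrary choice of optimisers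
    [H_]. *)
Lemma cvg_JH_optimizer mu nu1 nu2 H (k : V -> R) (H_ : R -> V -> R) :
  (forall x, 0 < mu x) -> DV r mu = JH r H mu ->
  (forall s, (forall x, 0 < (mu + s *: nu2) x) ->
     DV r (mu + s *: nu2) = JH r (H_ s) (mu + s *: nu2)) ->
  (forall f, \sum_p flux mu H p * grad f p * grad k p =
     - \sum_p flux nu2 H p * grad f p) ->
  s^-1 * (JH r (H_ s) nu1 - JH r H nu1) @[s --> 0^'] -->
    - \sum_p flux nu1 H p * grad k p.
Proof.
move=> mu0 HH H_opt kE.
have [K [del [K0 del0 lip]]] := optimizer_lipschitz nu2 mu0 HH.
pose M1 := \sum_x `|nu1 x| / mu x; pose M2 := \sum_x `|nu2 x| / mu x.
have M10 : 0 <= M1 by apply: sumr_ge0 => x _; rewrite divr_ge0// ltW.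
have M20 : 0 <= M2 by apply: sumr_ge0 => x _; rewrite divr_ge0// ltW.
pose c := flux mu H; have c0 p : 0 <= c p by exact: flux_ge0.
pose E := M1 * ((4 * K ^+ 2 + 2 * M2 * K) * \sum_p c p).
apply: (@cvg_linear_error _ _ E del) => // s s0 sd.
have [mus0 Ks ts] := lip s sd; have Hs := H_opt s mus0.
pose u := H_ s - H; have us := ts _ Hs.
have vE p : grad (u + (- s) *: k) p = grad u p - s * grad k p.
  by rewrite gradDZ mulNr.
have crit0 := optimizer_critical (u + (- s) *: k) mu0 HH.
have crits := optimizer_critical (u + (- s) *: k) mus0 Hs.
have critk := kE (u + (- s) *: k).
have v_small : \sum_p c p * `|grad u p - s * grad k p| <=
    (2 * (K * `|s|) ^+ 2 + 2 * `|s| * M2 * (K * `|s|)) * \sum_p c p.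
  apply: (@expansion_remainder _ _ c (flux nu2 H)) => //.
  - by move=> p; exact: flux_dominated.
  - by rewrite mulr_ge0.
  - by rewrite -[RHS]crit0; apply: eq_bigr => p _; rewrite vE.
  - by rewrite -[RHS]crits; apply: eq_bigr => p _; rewrite vE (flux_line _ _ H).
  - under eq_bigr do rewrite -vE mulrAC; rewrite critk.
    by congr (- _); apply: eq_bigr => p _; rewrite vE.
have := @exp_sum_expansion _ _ c (flux nu1 H) (grad u) (grad k) M1 s (K * `|s|) _
  c0 (fun p => flux_dominated nu1 H p mu0) Ks M10 us v_small.
rewrite JHB; set S := \sum_p _ * _; set T := \sum_p _ * grad k p => ST.
have -> : s^-1 * - S - - T = - (s^-1 * (S - s * T)) by field.
rewrite normrN normrM normfV mulrC ler_pdivrMr ?normr_gt0//.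
apply: le_trans ST _; rewrite /E le_eqVlt; apply/orP; left; apply/eqP; ring.
Qed.

Lemma second_derivative_DV mu nu1 nu2 :
  (forall x, 0 < mu x) -> \sum_x mu x = 1 ->
  let f1 := fun x => nu1 x / mu x in
  let f2 := fun x => nu2 x / mu x in
  let L := gen (tilt r (Hopt r mu)) in
  let Ladj := adjoint mu L in
  let Ls := sym_part mu L in
  (\forall e \near (0 : R),
      cvg (DV_quotient r (mu + e *: nu2) nu1 t @[t --> 0^'])) /\
  e^-1 * (dDV r (mu + e *: nu2) nu1 - dDV r mu nu1) @[e --> 0^'] -->
    2^-1 * inner mu f1 (L (inv_mean0 mu (fun g => - Ls g) (Ladj f2))).
Proof.
move=> mu0 mu1 f1 f2 L Ladj Ls.
have HoptE m : (forall x, 0 < m x) -> DV r m = JH r (Hopt r m) m.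
  by move=> /exists_optimizer/(xgetPex 0).
have HH := HoptE _ mu0; set H := Hopt r mu in L Ladj Ls HH *.
have [K [del [_ del0 lip]]] := optimizer_lipschitz nu2 mu0 HH.
have mus0 : \forall e \near (0 : R), forall x, 0 < (mu + e *: nu2) x.
  by apply: filterS (nbhs0_lt del0) => e /lip[].
have cvgq m : (forall x, 0 < m x) ->
    DV_quotient r m nu1 t @[t --> 0^'] --> JH r (Hopt r m) nu1.
  by move=> m0; apply: cvg_DV_quotient => //; exact: HoptE.
have dDVE m : (forall x, 0 < m x) -> dDV r m nu1 = JH r (Hopt r m) nu1.
  by move=> m0; apply: cvg_lim => //; exact: cvgq.
split.
  apply: filterS mus0 => e /cvgq cvge.
  by apply/cvg_ex; exists (JH r (Hopt r (mu + e *: nu2)) nu1).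
set g := inv_mean0 _ _ _; pose k := (- 2^-1) *: g.
have gradk p : grad k p = - 2^-1 * grad g p.
  by rewrite /grad /k !fctE /GRing.scale/=; ring.
have gE f := inv_mean0_sym_part nu2 mu0 mu1 HH f.
have kE f : \sum_p flux mu H p * grad f p * grad k p =
     - \sum_p flux nu2 H p * grad f p.
  transitivity (- 2^-1 * \sum_p flux mu H p * grad f p * grad g p).
    by rewrite mulr_sumr; apply: eq_bigr => p _; rewrite gradk; ring.
  by rewrite gE mulrA mulNr mulVf// mulN1r.
(* Since [mu * f1 = nu1], the pairing with [L g] is a sum of the [nu1] flow against [grad g]. *)
have -> : 2^-1 * inner mu f1 (L g) = - \sum_p flux nu1 H p * grad k p.
  rewrite inner_gen mulr_sumr -sumrN; apply: eq_bigr => p _.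
  by rewrite gradk /flux /f1; field; rewrite gt_eqF.
have := @cvg_JH_optimizer _ nu1 nu2 _ k (fun s => Hopt r (mu + s *: nu2)) mu0 HH
  (fun s => @HoptE _) kE.
apply: cvg_trans; apply: near_eq_cvg.
apply: filterS (nbhs_dnbhs mus0) => e me; rewrite !dDVE//.
Qed.

End Optimizers.

(** * Removal of the diagonal rates *)

Section OffDiagonal.
Context {R : realType} {V : finType}.
Variable r : V -> V -> R.

(** Diagonal rates may be negative, whereas the estimates above assume all rates nonnegative. *)
Definition off_diagonal (x y : V) : R := if x == y then 0 else r x y.

Lemma off_diagonal_ge0 : jump_rates r -> forall x y, 0 <= off_diagonal x y.
Proof. by move=> r0 x y; rewrite /off_diagonal; case: eqVneq => // /r0. Qed.

Lemma off_diagonal_irreducible :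
  irreducible_rates r -> irreducible_rates off_diagonal.
Proof.
move=> irr x y; apply: connect_sub (irr x y) => {x y} x y rxy.
have [->|xy] := eqVneq x y; first exact: connect0.
by apply: connect1; rewrite /off_diagonal (negPf xy).
Qed.

Lemma JH_off_diagonal : JH off_diagonal = JH r.
Proof.
apply/funext => H; apply/funext => mu.
apply: eq_bigr => x _; apply: eq_bigr => y _; rewrite /off_diagonal.
by case: eqVneq => // ->; rewrite subrr expR0 subrr !mulr0.
Qed.

Lemma DV_off_diagonal : DV off_diagonal = DV r.
Proof. by rewrite /DV JH_off_diagonal. Qed.

Lemma gen_tilt_off_diagonal H : gen (tilt off_diagonal H) = gen (tilt r H).
Proof.
apply/funext => f; apply/funext => x; apply: eq_bigr => y _.
by rewrite /tilt /off_diagonal; case: eqVneq => // ->; rewrite (subrr (f _)) !mulr0.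
Qed.

End OffDiagonal.

Theorem proposition5p13 (R : realType) (V : finType) (r : V -> V -> R)
    (mu nu1 nu2 : V -> R)
    (r_rates : jump_rates r) (r_irr : irreducible_rates r)
    (mu_gt0 : forall x, 0 < mu x) (mu_sum1 : \sum_x mu x = 1)
    (nu1_sum0 : \sum_x nu1 x = 0) (nu2_sum0 : \sum_x nu2 x = 0) :
  let f1 := fun x => nu1 x / mu x in
  let f2 := fun x => nu2 x / mu x in
  let L := gen (tilt r (Hopt r mu)) in
  let Ladj := adjoint mu L in
  let Ls := sym_part mu L in
  (\forall e \near (0 : R),
      cvg (DV_quotient r (mu + e *: nu2) nu1 t @[t --> 0^'])) /\
  e^-1 * (dDV r (mu + e *: nu2) nu1 - dDV r mu nu1) @[e --> 0^'] -->
    2^-1 * inner mu f1 (L (inv_mean0 mu (fun g => - Ls g) (Ladj f2))).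
Proof.
have := second_derivative_DV (off_diagonal_ge0 r_rates)
  (off_diagonal_irreducible r_irr) nu1 nu2 mu_gt0 mu_sum1.
(* Once unfolded, the statement sees the rates only through [JH], [DV] and the tilted generator, all
   blind to the diagonal. *)
rewrite /Hopt /dDV /DV_quotient JH_off_diagonal DV_off_diagonal.
by rewrite gen_tilt_off_diagonal.
Qed.
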